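(* Let $G(n)$ denote the number of ordered factorizations of a positive integer $n$ into pairwise coprime integers larger than one. For every fixed $\beta \in (0,1)$, as $x\to\infty$, \[\sum_{n \leq x} G(n)^\beta = x\exp\left((1 + o(1)) \frac{1 - \beta}{(\log 2)^{\beta/(1 - \beta)}} (\log_2 x)^{1/(1 - \beta)}\right).\]
   Context: $\log_k$ denotes the $k$-th iterate of the natural logarithm. *)

(* Defs.v *)
From mathcomp Require Import all_boot all_order all_algebra finmap.
From mathcomp Require Import all_classical all_reals all_analysis.
Set Implicit Arguments.
Unset Strict Implicit.
Unset Printing Implicit Defensive.

Import Order.TTheory GRing.Theory Num.Theory.
Local Open Scope classical_set_scope.
Local Open Scope nat_scope.

Definition coprime_factorizations (n : nat) : set (seq nat) :=
  [set s | [/\ all (fun d => 1 < d) s, pairwise coprime s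
             & \prod_(d <- s) d = n]].

Lemma prod_gt1_bounds (s : seq nat) : all (fun d => 1 < d) s ->
  size s < \prod_(d <- s) d /\ all (fun d => d <= \prod_(d <- s) d) s.
Proof.
elim: s => [|a s IH] /=; first by rewrite big_nil.
case/andP=> a1 /IH [szs als]; rewrite big_cons; set p := bigop _ _ _ in szs als *.
have p0 : 0 < p by apply: leq_trans szs.
split.
  by apply: (leq_trans (n := 2 * p)); [rewrite mul2n -addnn -(addn1 (size s).+1) leq_add | rewrite leq_mul2r a1 orbT].
rewrite leq_pmulr //=; apply: sub_all als => d /leq_trans -> //.
by rewrite leq_pmull // ltnW.
Qed.

(* [fset_set] is junk on infinite sets, which this rules out for [G]. *)
Lemma finite_coprime_factorizations (n : nat) :
  finite_set (coprime_factorizations n).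
Proof.
apply: (@sub_finite_set _ _ (\bigcup_(k in `I_n.+1)
   range (fun t : k.-tuple 'I_n.+1 => map val t))); last first.
  apply: bigcup_finite; first exact: finite_II.
  by move=> k _; apply: finite_image; exact: finite_finset.
move=> s [s1 _ sn]; have [szs als] := prod_gt1_bounds s1; rewrite sn in szs als.
exists (size s); first by rewrite /= ltnW.
exists (map_tuple inord (in_tuple s)) => //=.
rewrite -map_comp -[RHS]map_id; apply/eq_in_map => d ds /=.
by rewrite inordK // ltnS (allP als).
Qed.

(* The empty factorization counts, so [G 1 = 1]. *)
Definition G (n : nat) : nat := #|` fset_set (coprime_factorizations n)|%fset.

Definition iter_ln (R : realType) (k : nat) (x : R) : R := iter k (@ln R) x.

(* Main.v *)
(* With [w] the number of distinct primes of [n], [G n] is the [w]-th ordered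
   Bell number, which lies between [w! / (2 (ln 2)^w)] and [w! / (ln 2)^w]; this
   follows by induction from the recursion that removes the first factor, since
   the unitary divisors of [n] correspond to the sets of primes of [n].

   Upper bound: for each natural [z], [sum_(n <= N) z^w / n <= H_N^z] with [H_N]
   the harmonic sum, because [z^w] is at most the number of factorizations of
   [n] into [z] factors.  Hence at most [N H_N^z / z^k] integers have [w = k],
   and taking [z] about [k / ln (ln x)] for each [k] is sharp enough.

   Lower bound: for real [z >= 1], [G n ^ beta] is at least a constant depending
   on [z] times [z^w], and [z^w >= (z-1)^k 'C(w, k)].  The sum of ['C(w, k)] over
   [n <= N] is at least [N / 2] times the [k]-th elementary symmetric function of
   the [1 / p], over primes [k < p <= N^(1/k)].  As every [1 / p] is below [1 / k],
   that function is at least [(S - 1)^k / k!] with [S] the sum of the [1 / p], and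
   [S] is estimated from below by Euler's argument.  Optimizing in [z] gives
   [z = (l / ln 2)^(beta / (1 - beta))] and [k = z l], where [l = ln (ln x)]. *)
Require Import Defs.
From mathcomp Require Import all_boot all_order all_algebra.
From mathcomp Require Import finmap ring lra zify.
From mathcomp Require Import all_classical all_reals all_analysis.
Import Order.TTheory GRing.Theory Num.Theory.
Import numFieldNormedType.Exports.

Set Implicit Arguments.
Unset Strict Implicit.
Unset Printing Implicit Defensive.

(** * Unitary divisors and the recursion for G *)

Definition omega (n : nat) : nat := size (primes n).

Definition unitary_divisors (n : nat) : seq nat :=
  [seq d <- divisors n | coprime d (n %/ d)].

Lemma mem_unitary (n d : nat) : 0 < n ->
  (d \in unitary_divisors n) = (d %| n) && coprime d (n %/ d).
Proof. by move=> n0; rewrite mem_filter -dvdn_divisors// andbC. Qed.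

(** As [n %/ d] is coprime to [d], it contributes nothing at the primes of [d]. A unitary divisor is
    thus determined by its set of primes. *)
Lemma unitary_part (n d : nat) : 0 < n -> d \in unitary_divisors n ->
  d = n`_\pi(d).
Proof.
move=> n0; rewrite mem_unitary// => /andP[dn cd].
have d0 : 0 < d by apply: dvdn_gt0 dn.
have e0 : 0 < n %/ d by rewrite divn_gt0 // dvdn_leq.
rewrite -{1}(divnK dn) partnM// mulnC partn_pi// part_p'nat ?muln1//.
by rewrite -coprime_pi'.
Qed.

Lemma part_unitary (pi : nat_pred) (n : nat) : 0 < n ->
  n`_pi \in unitary_divisors n.
Proof.
move=> n0; rewrite mem_unitary// dvdn_part /=.
have -> : n %/ n`_pi = n`_pi^'.
  by rewrite -{1}(partnC pi n0) mulKn// part_gt0.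
by apply: (@pnat_coprime pi); apply: part_pnat.
Qed.

Lemma omega_div (n d : nat) : 0 < n -> d \in unitary_divisors n ->
  omega (n %/ d) = omega n - omega d.
Proof.
move=> n0 dU; have dE := unitary_part n0 dU.
have -> : n %/ d = n`_(\pi(d))^'.
  by rewrite -{1}(partnC \pi(d) n0) -dE mulKn// dE part_gt0.
rewrite [in RHS]dE /omega !primes_part !size_filter.
rewrite -(count_predC (mem \pi(d)) (primes n)) addKn.
by apply: eq_count => p; rewrite !inE.
Qed.

(** Ordinals are used so that the sets of primes form a finite type, where binomials count them. *)
Definition prime_set (n : nat) : {set 'I_n.+1} :=
  [set p : 'I_n.+1 | val p \in primes n].

Lemma card_prime_set (n : nat) : #|prime_set n| = omega n.
Proof.
rewrite /omega -(size_map (@inord n)) -(card_uniqP _); last first.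
  rewrite map_inj_in_uniq ?primes_uniq// => p q.
  rewrite !mem_primes => /and3P[_ n0 /dvdn_leq -/(_ n0) pn].
  move=> /and3P[_ _ /dvdn_leq -/(_ n0) qn] /(congr1 val) /=.
  by rewrite !inordK.
apply: eq_card => p; rewrite inE; apply/idP/mapP => [pP|[q qP ->]].
  by exists (val p) => //; rewrite inord_val.
rewrite /= inordK //.
by move: qP; rewrite mem_primes => /and3P[_ n0 /dvdn_leq -/(_ n0)].
Qed.

(** The inverse of the map from a unitary divisor to its set of primes. [inord] sends numbers above
    [n] to 0, which is harmless since no prime of [n] exceeds [n]. *)
Definition subset_part (n : nat) (A : {set 'I_n.+1}) : nat :=
  n`_[pred p : nat | (inord p : 'I_n.+1) \in A].

Lemma primes_subset_part (n : nat) (A : {set 'I_n.+1}) (p : 'I_n.+1) :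
  A \subset prime_set n -> (val p \in primes (subset_part A)) = (p \in A).
Proof.
move=> /fintype.subsetP AP; rewrite /subset_part primes_part mem_filter inE inord_val.
by apply: andb_idr => /AP; rewrite inE.
Qed.

Lemma omega_subset_part (n : nat) (A : {set 'I_n.+1}) :
  A \subset prime_set n -> omega (subset_part A) = #|A|.
Proof.
move=> AP; rewrite -card_prime_set.
have lepn p : p \in primes (subset_part A) -> p <= n.
  rewrite primes_part mem_filter mem_primes => /andP[_ /and3P[_ n0 /dvdn_leq]].
  exact.
rewrite card_prime_set /omega -(size_map (@inord n)) -(card_uniqP _); last first.
  rewrite map_inj_in_uniq ?primes_uniq// => p q /lepn pn /lepn qn.
  by move=> /(congr1 val) /=; rewrite !inordK.
apply: eq_card => p; rewrite -(primes_subset_part _ AP).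
apply/mapP/idP => [[q qP ->]|pP]; first by rewrite /= inordK// ltnS lepn.
by exists (val p) => //; rewrite inord_val.
Qed.

Lemma unitary_divisors_subsets (n : nat) : 0 < n ->
  perm_eq (unitary_divisors n)
    [seq subset_part A | A : {set 'I_n.+1} in powerset (prime_set n)].
Proof.
move=> n0; apply: uniq_perm.
- by rewrite filter_uniq// divisors_uniq.
- rewrite map_inj_in_uniq ?enum_uniq// => A B.
  rewrite !mem_enum !powersetE => AP BP eAB.
  apply/setP => p.
  by rewrite -(primes_subset_part _ AP) -(primes_subset_part _ BP) eAB.
move=> d; apply/idP/fintype.imageP => [dU|[A _ ->]]; last exact: part_unitary.
have dn : d %| n by move: dU; rewrite mem_unitary// => /andP[].
exists [set p : 'I_n.+1 | val p \in primes d].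
  rewrite powersetE; apply/fintype.subsetP => p; rewrite !inE !mem_primes.
  by move=> /and3P[-> d0 /dvdn_trans -> //]; rewrite n0.
rewrite [LHS](unitary_part n0 dU) /subset_part; apply: eq_in_partn => p pn.
rewrite !inE /= inordK // ltnS.
by move: pn; rewrite mem_primes => /and3P[_ _ /dvdn_leq]; exact.
Qed.

Lemma sum_unitary (V : nmodType) (n : nat) (F : nat -> V) : 0 < n ->
  (\sum_(d <- unitary_divisors n) F (omega d)
   = \sum_(i < (omega n).+1) F i *+ 'C(omega n, i))%R.
Proof.
move=> n0; rewrite (perm_big _ (unitary_divisors_subsets n0)) /= big_image /=.
under eq_bigr => A AP.
  rewrite omega_subset_part; last by rewrite -powersetE.
  over.
have cA (A : {set 'I_n.+1}) : A \in powerset (prime_set n) ->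
    #|A| < (omega n).+1.
  by rewrite powersetE ltnS -card_prime_set => /subset_leq_card.
rewrite (partition_big (fun A : {set 'I_n.+1} => inord #|A| : 'I_(omega n).+1)
  xpredT)//=.
apply: eq_bigr => i _.
have <- : #|[set A : {set 'I_n.+1} | A \subset prime_set n & #|A| == i]| = 'C(omega n, i).
  by rewrite cards_draws card_prime_set.
rewrite -sumr_const; apply: eq_big => [A|A /andP[AP /eqP <-]].
  rewrite inE powersetE; apply: andb_id2l => AP.
  by rewrite -val_eqE /= inordK // cA// powersetE.
by rewrite inordK // cA.
Qed.
Lemma G_size (n : nat) (s : seq (seq nat)) : uniq s ->
  (forall x, coprime_factorizations n x <-> x \in s) -> G n = size s.
Proof.
move=> us sP; rewrite /G.
have -> : fset_set (coprime_factorizations n) = [fset x in s]%fset.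
  apply/fsetP => x; rewrite in_fset_set; last exact: finite_coprime_factorizations.
  by rewrite inE; apply/idP/idP; rewrite in_setE => /sP.
by rewrite card_fseq undup_id.
Qed.

Lemma G1 : G 1 = 1.
Proof.
apply: (@G_size _ [:: [::]]) => // x; rewrite inE; split => [[]|/eqP ->].
  case: x => [//|a s] /= /andP[a1 s1] _ aE; exfalso.
  have := @prod_gt1_bounds (a :: s); rewrite /= a1 s1 aE => /(_ isT)[_ /andP[]].
  by rewrite leqNgt a1.
by split => //; rewrite big_nil.
Qed.

Lemma all_coprime_prod (d : nat) (s : seq nat) :
  all (coprime d) s = coprime d (\prod_(i <- s) i).
Proof.
elim: s => [|a s IH]; first by rewrite big_nil coprimen1.
by rewrite big_cons coprimeMr /= IH.
Qed.

(** The first factor [d] is coprime to all later ones exactly when it is coprime to their product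
    [n %/ d], that is, when [d] is unitary. For [n = 1] the empty factorization has no first
    factor. *)
Lemma G_rec (n : nat) : 1 < n ->
  G n = \sum_(d <- unitary_divisors n | d != 1) G (n %/ d).
Proof.
move=> n1; have n0 : 0 < n by apply: ltnW.
pose D := [seq d <- unitary_divisors n | d != 1].
pose F m : seq (seq nat) := fset_set (coprime_factorizations m).
have FP m x : (x \in F m) <-> coprime_factorizations m x.
  rewrite /F in_fset_set; last exact: finite_coprime_factorizations.
  by rewrite in_setE.
rewrite (@G_size n [seq d :: s | d <- D, s <- F (n %/ d)]).
- by rewrite size_allpairs_dep sumnE big_map big_filter; apply: eq_bigr.
- apply: allpairs_uniq_dep => /=.
  + by rewrite !filter_uniq// divisors_uniq.
  + by move=> d _; exact: fset_uniq.
  + by move=> [d s] [e t] _ _ /= [-> ->].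
move=> x; split=> [[]|].
  case: x => [_ _|d s] /=; first by rewrite big_nil => n1'; rewrite -n1' in n1.
  move=> /andP[d1 s1] /andP[ds sP]; rewrite big_cons => nE.
  have d0 : 0 < d by apply: ltnW.
  have ndE : n %/ d = \prod_(j <- s) j by rewrite -nE mulKn.
  apply/allpairsPdep; exists d, s; split => //.
    rewrite mem_filter mem_unitary// neq_ltn d1 orbT /= ndE -all_coprime_prod ds.
    by rewrite -nE dvdn_mulr.
  by apply/FP; split.
move=> /allpairsPdep[d [s [dD /FP[s1 sP sE] ->]]].
move: dD; rewrite mem_filter mem_unitary// => /and3P[d1 dn cd].
have d0 : 0 < d by apply: dvdn_gt0 dn.
split; rewrite /= ?s1 ?sP ?andbT.
- by rewrite ltn_neqAle eq_sym d1.
- by rewrite all_coprime_prod sE.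
- by rewrite big_cons sE mulnC divnK.
Qed.
(** * Bounds for G by factorials *)

Section ExpPartialSums.
Variable R : realType.
Local Open Scope ring_scope.
Implicit Types x c : R.

Lemma le_series_exp_coeff x (m n : nat) : 0 <= x -> (m <= n)%N ->
  series (exp_coeff x) m <= series (exp_coeff x) n.
Proof.
move=> x0 mn; rewrite /series /= (big_cat_nat _ mn)//= lerDl sumr_ge0// => i _.
exact: exp_coeff_ge0.
Qed.

Lemma series_exp_coeff_le x (n : nat) : 0 <= x ->
  series (exp_coeff x) n <= expR x.
Proof.
move=> x0; apply: nondecreasing_cvgn_le; last exact: is_cvg_series_exp_coeff.
by move=> m p; exact: le_series_exp_coeff.
Qed.

(** Since (n + i)! is at least n! i!, the tail from index [n] on is at most [exp_coeff x n] times
    the whole series. *)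
Lemma expR_le_series x (n : nat) : 0 <= x ->
  expR x <= series (exp_coeff x) n + exp_coeff x n * expR x.
Proof.
move=> x0; apply: limr_le; first exact: is_cvg_series_exp_coeff.
apply: nearW => m.
apply: (le_trans (le_series_exp_coeff x0 (leq_addl n m))).
rewrite /series /= (big_cat_nat _ (leq_addr m n))//= lerD2l.
rewrite -{1}[n]add0n big_addn [(n + m)%N]addnC addnK.
apply: (@le_trans _ _ (exp_coeff x n * series (exp_coeff x) m)); last first.
  by rewrite ler_wpM2l ?exp_coeff_ge0// series_exp_coeff_le.
rewrite /series /= mulr_sumr ler_sum// => i _; rewrite /exp_coeff /=.
rewrite exprD [leLHS]mulrC mulrACA -invfM [x ^+ n * _]mulrC [leRHS]mulrC.
rewrite ler_wpM2r ?mulr_ge0 ?exprn_ge0// lef_pV2 ?posrE ?ltr0n ?fact_gt0//.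
rewrite -natrM ler_nat -(bin_fact (leq_addl i n)) addnK mulnC.
by rewrite leq_pmull// bin_gt0 leq_addl.
Qed.

Lemma ln2_gt0 : 0 < ln 2 :> R.
Proof. by rewrite ln_gt0 ?ltr1n. Qed.

Lemma ln2_le1 : ln 2 <= 1 :> R.
Proof. by rewrite -[2]/(1 + 1) le_ln1Dx//; lra. Qed.

(** With k = [omega n], C(k, i) (k - i)! / c^(k - i) equals (k! / c^k) (c^i / i!). The recursion for
    [G] thus meets the exponential series without its constant term, whose full sum is 1 for c = ln
    2. *)
Lemma sum_unitary_fact c (n : nat) : (0 < n)%N -> c != 0 ->
  \sum_(d <- unitary_divisors n | d != 1%N)
     ((omega n - omega d)`!%:R / c ^+ (omega n - omega d))
  = (omega n)`!%:R / c ^+ omega n * \sum_(1 <= i < (omega n).+1) exp_coeff c i.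
Proof.
move=> n0 c0; set k := omega n.
(* The value 0 at [i = 0] leaves out the divisor 1, the only one without primes. *)
pose F i : R := if i == 0%N then 0 else (k - i)`!%:R / c ^+ (k - i).
transitivity (\sum_(d <- unitary_divisors n) F (omega d)).
  rewrite big_mkcond /= big_seq_cond [RHS]big_seq_cond.
  apply: eq_bigr => d /[!andbT]; rewrite mem_unitary// => /andP[dn _].
  have d0 : (0 < d)%N by apply: dvdn_gt0 dn.
  have -> : (d != 1%N) = (omega d != 0%N).
    by rewrite /omega size_eq0 primes_eq0 ltnS leq_eqVlt ltnS leqn0 [d == 0%N]gtn_eqF// orbF.
  by rewrite /F; case: eqP.
rewrite sum_unitary// big_ord_recl /F /= mul0rn add0r.
rewrite big_add1 /= big_mkord mulr_sumr; apply: eq_bigr => i _ /=.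
rewrite /bump /= add1n; have ik : (i.+1 <= k)%N by [].
rewrite -[LHS]mulr_natl -(bin_fact ik) /exp_coeff /= (natrM _ 'C(_, _)) (natrM _ i.+1`!).
have -> : c ^+ k = c ^+ i.+1 * c ^+ (k - i.+1) by rewrite -exprD subnKC.
have fn m : m`!%:R != 0 :> R by rewrite pnatr_eq0 -lt0n fact_gt0.
have cn m : c ^+ m != 0 by rewrite expf_neq0.
move: (fn i.+1) (cn i.+1) (cn (k - i.+1)%N).
move: (_ ^+ i.+1) (_ ^+ (k - i.+1)%N) => u v; move: (i.+1)`!%:R => w w0 u0 v0.
by field; rewrite w0 u0 v0.
Qed.

Lemma G_ub (n : nat) : (0 < n)%N ->
  (G n)%:R <= (omega n)`!%:R / (ln 2) ^+ omega n :> R.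
Proof.
elim/ltn_ind: n => n IH n0.
have := n0; rewrite leq_eqVlt => /predU1P[<-|n1].
  by rewrite G1 /omega /= expr0 divr1.
have c0 : ln 2 != 0 :> R by rewrite gt_eqF// ln2_gt0.
rewrite G_rec// natr_sum.
apply: (@le_trans _ _ (\sum_(d <- unitary_divisors n | d != 1%N)
     ((omega n - omega d)`!%:R / ln 2 ^+ (omega n - omega d)))).
  rewrite big_seq_cond [leRHS]big_seq_cond; apply: ler_sum => d /andP[dU d1].
  rewrite -omega_div//; move: dU; rewrite mem_unitary// => /andP[dn _].
  have d0 : (0 < d)%N by apply: dvdn_gt0 dn.
  apply: IH; last by rewrite divn_gt0// dvdn_leq.
  by rewrite ltn_Pdiv// ltn_neqAle eq_sym d1.
rewrite sum_unitary_fact// ler_piMr//.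
  by rewrite divr_ge0// exprn_ge0// ltW// ln2_gt0.
have := @series_exp_coeff_le (ln 2) (omega n).+1 (ltW ln2_gt0).
rewrite lnK ?posrE// /series /= big_nat_recl// big_add1 /= {1}/exp_coeff /=.
by rewrite expr0 divr1; lra.
Qed.

(** The divisor [d = n] contributes [G 1 = 1], where the inductive bound would give 1/2. The surplus
    1/2 pays for the missing tail of the exponential series, which costs at most ln 2 / (k + 1) <=
    1/2 for k = [omega n] >= 1. *)
Lemma G_lb (n : nat) : (0 < n)%N ->
  2^-1 * ((omega n)`!%:R / (ln 2) ^+ omega n) <= (G n)%:R :> R.
Proof.
elim/ltn_ind: n => n IH n0.
have := n0; rewrite leq_eqVlt => /predU1P[<-|n1].
  by rewrite G1 /omega /= expr0 divr1 mulr1; lra.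
have c0 : ln 2 != 0 :> R by rewrite gt_eqF// ln2_gt0.
have nU : n \in unitary_divisors n by rewrite mem_unitary// dvdnn divnn n0 coprimen1.
have nn1 : n != 1%N by rewrite gtn_eqF.
apply: (@le_trans _ _ (2^-1 + 2^-1 * \sum_(d <- unitary_divisors n | d != 1%N)
     ((omega n - omega d)`!%:R / ln 2 ^+ (omega n - omega d)))); last first.
  have bD (F : nat -> R) : \sum_(d <- unitary_divisors n | d != 1%N) F d
      = F n + \sum_(d <- unitary_divisors n | (d != 1%N) && (d != n)) F d.
    rewrite -big_filter (bigD1_seq n) ?big_filter_cond//.
      by rewrite mem_filter nn1.
    by rewrite !filter_uniq// divisors_uniq.
  rewrite G_rec// natr_sum mulr_sumr !bD.
  rewrite subnn divnn n0 G1.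
  rewrite expr0 divr1 mulr1 addrA; apply: lerD; first by lra.
  rewrite big_seq_cond [leRHS]big_seq_cond; apply: ler_sum => d /and3P[dU d1 _].
  rewrite -omega_div//; move: dU; rewrite mem_unitary// => /andP[dn _].
  have d0 : (0 < d)%N by apply: dvdn_gt0 dn.
  apply: IH; last by rewrite divn_gt0// dvdn_leq.
  by rewrite ltn_Pdiv// ltn_neqAle eq_sym d1.
rewrite sum_unitary_fact//; set k := omega n; set f := _ / _.
have f0 : 0 < f by rewrite divr_gt0 ?exprn_gt0 ?ln2_gt0// ltr0n fact_gt0.
have := @expR_le_series (ln 2) k.+1 (ltW ln2_gt0).
rewrite lnK ?posrE// /series /= big_nat_recl// [X in _ + X + _ * _](_ : _ =
  \sum_(1 <= i < k.+1) exp_coeff (ln 2) i); last by rewrite big_add1.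
rewrite {1}/exp_coeff /= expr0 divr1; set S := bigop _ _ _ => S2.
have k1 : (1 <= k)%N.
  by rewrite /k /omega lt0n size_eq0 primes_eq0 -leqNgt.
have fE : f * exp_coeff (ln 2) k.+1 = ln 2 / k.+1%:R.
  rewrite /f /exp_coeff /= factS natrM exprS.
  have : k`!%:R != 0 :> R by rewrite pnatr_eq0 -lt0n fact_gt0.
  have : ln 2 ^+ k != 0 :> R by rewrite expf_neq0.
  have : k.+1%:R != 0 :> R by rewrite pnatr_eq0.
  move: k`!%:R (_ ^+ k) k.+1%:R => u v w w0 v0 u0.
  by field; rewrite u0 v0 w0.
have : f * exp_coeff (ln 2) k.+1 * 2 <= 1.
  rewrite fE mulrAC ler_pdivrMr ?ltr0n// mul1r.
  apply: (@le_trans _ _ (1 * 2)); first by rewrite ler_wpM2r// ln2_le1.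
  by rewrite mul1r ler_nat.
have : f * 2 <= f * (1 + S + exp_coeff (ln 2) k.+1 * 2) by rewrite ler_pM2l.
rewrite mulrA; lra.
Qed.

End ExpPartialSums.
(** * Upper bound *)

Lemma sum_multiples (V : nmodType) (F : nat -> V) (d N : nat) : 0 < d ->
  (\sum_(1 <= n < N.+1 | (d %| n)%N) F n
   = \sum_(1 <= m < (N %/ d).+1) F (d * m)%N)%R.
Proof.
move=> d0; rewrite -big_filter -(big_map (muln d) xpredT F); apply: perm_big.
apply: uniq_perm.
- by rewrite filter_uniq ?iota_uniq.
- rewrite map_inj_uniq ?iota_uniq// => a b /eqP.
  by rewrite eqn_pmul2l// => /eqP.
move=> n; rewrite mem_filter mem_index_iota; apply/idP/mapP.
  move=> /andP[/dvdnP[m ->]]; rewrite muln_gt0 ltnS => /andP[/andP[m0 _] mN].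
  by exists m; rewrite 1?mulnC// mem_index_iota m0 ltnS leq_divRL.
move=> [m]; rewrite mem_index_iota ltnS leq_divRL// => /andP[m0 mN] ->.
by rewrite dvdn_mulr// muln_gt0 d0 m0 ltnS mulnC.
Qed.

(** The left side is the number of unitary divisors. *)
Lemma omega_le (n : nat) : 0 < n -> 2 ^ omega n <= n.
Proof.
move=> n0.
have -> : 2 ^ omega n = size (unitary_divisors n).
  rewrite -sum1_size (sum_unitary (fun _ => 1) n0) -[2]/(1 + 1) expnDn.
  by apply: eq_bigr => i _; rewrite !exp1n !muln1 -mulr_natr natn mul1r.
apply: (@leq_trans (size (iota 1 n))); last by rewrite size_iota.
apply: uniq_leq_size; first by rewrite filter_uniq// divisors_uniq.
move=> d; rewrite mem_unitary// => /andP[dn _].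
by rewrite mem_iota (dvdn_gt0 n0 dn) add1n ltnS dvdn_leq.
Qed.

Section UpperBound.
Variable R : realType.
Local Open Scope ring_scope.

Definition harmonic_sum (N : nat) : R := \sum_(1 <= n < N.+1) n%:R^-1.

Lemma harmonic_sum_ge0 (N : nat) : 0 <= harmonic_sum N.
Proof. by apply: sumr_ge0 => i _; rewrite invr_ge0. Qed.

Lemma le_harmonic_sum (M N : nat) : (M <= N)%N ->
  harmonic_sum M <= harmonic_sum N.
Proof.
move=> MN; rewrite /harmonic_sum [leRHS](@big_cat_nat _ _ _ M.+1)//= lerDl.
by rewrite sumr_ge0// => i _; rewrite invr_ge0.
Qed.

Lemma harmonic_sum_le (N : nat) : (0 < N)%N -> harmonic_sum N <= 1 + ln N%:R.
Proof.
elim: N => [//|[_ _|N IH _]].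
  by rewrite /harmonic_sum big_nat1 invr1 ln1 addr0.
rewrite /harmonic_sum big_nat_recr//= -/(harmonic_sum _).
apply: (le_trans (lerD (IH isT) (lexx _))); rewrite -addrA lerD2l.
set n := N.+1; have n0 : (0 : R) < n%:R by rewrite ltr0n.
have m0 : (0 : R) < n.+1%:R by rewrite ltr0n.
have E : 1 + - n.+1%:R^-1 = n%:R / n.+1%:R :> R.
  by rewrite -natr1; field; rewrite natr1 gt_eqF.
have := @le_ln1Dx R (- n.+1%:R^-1).
rewrite E ln_div ?posrE// ltrN2 invf_lt1// ltr1n => /(_ isT).
by move: (ln n%:R) (ln n.+1%:R) (n.+1%:R^-1) => a b c; lra.
Qed.

Lemma harmonic_sum_ge (N : nat) : ln N.+1%:R <= harmonic_sum N.
Proof.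
elim: N => [|N IH]; first by rewrite /harmonic_sum big_geq// ln1.
rewrite /harmonic_sum big_nat_recr//= -/(harmonic_sum _).
have n0 : (0 : R) < N.+1%:R by rewrite ltr0n.
have m0 : (0 : R) < N.+2%:R by rewrite ltr0n.
have E : 1 + N.+1%:R^-1 = N.+2%:R / N.+1%:R :> R.
  by rewrite -[N.+2%:R]natr1; field; rewrite gt_eqF.
have := @le_ln1Dx R (N.+1%:R^-1).
rewrite E ln_div ?posrE// (lt_trans (ltrN10 R)) ?invr_gt0// => /(_ isT).
by move: (ln N.+1%:R) (ln N.+2%:R) (N.+1%:R^-1) (IH) => a b c; lra.
Qed.

(** Induction on [z]: by the binomial theorem [z.+1 ^ omega n] is the sum of [z ^ omega d] over the
    unitary divisors [d] of [n]. Extending this to all divisors and writing [n = d * m] splits off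
    one harmonic sum. *)
Lemma sum_pow_omega_le (z N : nat) :
  \sum_(1 <= n < N.+1) (z ^ omega n)%:R / n%:R <= harmonic_sum N ^+ z.
Proof.
elim: z => [|z IH].
  (* For [z = 0] only [n = 1] contributes, because [0 ^ 0 = 1]. *)
  rewrite expr0; case: N => [|N]; first by rewrite big_geq.
  rewrite big_nat_recl//= divr1 big_nat big1 ?addr0 => [|i /andP[i1 _]].
    by rewrite lexx.
  rewrite exp0n ?mul0r// lt0n /omega size_eq0 primes_eq0; lia.
have ub n : (1 <= n < N.+1)%N -> (z.+1 ^ omega n)%:R / n%:R <=
    \sum_(1 <= d < N.+1 | (d %| n)%N) (z ^ omega d)%:R / n%:R :> R.
  move=> /andP[n0 nN]; rewrite -mulr_suml ler_wpM2r ?invr_ge0//.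
  rewrite -natr_sum ler_nat.
  have -> : (z.+1 ^ omega n = \sum_(d <- unitary_divisors n) z ^ omega d)%N.
    rewrite (sum_unitary (fun i => z ^ i)%N n0) -add1n expnDn.
    by apply: eq_bigr => i _; rewrite exp1n mul1n mulnC -mulr_natr natn.
  rewrite (perm_big [seq d <- index_iota 1 N.+1 | d \in unitary_divisors n]).
    rewrite big_filter big_mkcond [leqRHS]big_mkcond /=.
    apply: leq_sum => d _; rewrite mem_unitary//.
    by case: (d %| n)%N => //=; case: ifP.
  apply: uniq_perm; rewrite ?filter_uniq ?iota_uniq ?divisors_uniq// => d.
  rewrite [RHS]mem_filter mem_index_iota andb_idr// mem_unitary// => /andP[dn _].
  by rewrite (dvdn_gt0 n0 dn) (leq_ltn_trans (dvdn_leq n0 dn)).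
rewrite big_nat; apply: (le_trans (ler_sum _ ub)); rewrite -big_nat.
rewrite (exchange_big_dep xpredT)//= exprSr.
apply: le_trans (ler_wpM2r (harmonic_sum_ge0 N) IH).
rewrite mulr_suml big_nat [leRHS]big_nat; apply: ler_sum => d /andP[d0 dN].
rewrite sum_multiples// -mulr_sumr -mulrA ler_wpM2l//.
apply: (@le_trans _ _ (d%:R^-1 * harmonic_sum (N %/ d))).
  by rewrite mulr_sumr ler_sum// => m _; rewrite natrM invfM.
by rewrite ler_wpM2l ?invr_ge0// le_harmonic_sum// leq_div.
Qed.

(* The maximum over [u] of [u (1 + ln t - ln u)] is [t], attained at [u = t]. *)
Lemma mul_ln_ratio_le (j : nat) (t : R) : 0 < t ->
  j%:R * (1 + ln t - ln j%:R) <= t.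
Proof.
move=> t0; case: j => [|j]; first by rewrite mul0r ltW.
have : (0 : R) < j.+1%:R by rewrite ltr0n.
move: (j.+1%:R : R) => u u0.
have : ln (1 + (t / u - 1)) <= t / u - 1.
  by apply: le_ln1Dx; rewrite ltrBrDl subrr divr_gt0.
rewrite addrC subrK ln_div ?posrE// => h.
have {h} : 1 + ln t - ln u <= t / u by lra.
by rewrite -(ler_pM2l u0) [u * (t / u)]mulrC divfK// gt_eqF.
Qed.

(** The induction step is [mul_ln_ratio_le] at [t = k + 1]. Writing (k / e)^k with the product
    [k * ln k] covers [k = 0] too. *)
Lemma fact_ge (k : nat) : expR (k%:R * ln k%:R - k%:R) <= k`!%:R :> R.
Proof.
elim: k => [|k IH]; first by rewrite mul0r subr0 expR0.
rewrite factS natrM -natr1; set a : R := k%:R.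
have a0 : 0 <= a by rewrite ler0n.
have u0 : 0 < a + 1 by rewrite ltr_wpDl.
apply: le_trans (ler_wpM2l (ltW u0) IH).
rewrite -[X in _ <= X * _](lnK u0) -expRD ler_expR -/a.
have := mul_ln_ratio_le k u0; rewrite -/a.
move: (ln (a + 1)) (ln a) => v w.
nra.
Qed.

Lemma fact_le (k : nat) :
  k`!%:R <= k.+1%:R * expR (1 + (k%:R * ln k%:R - k%:R)) :> R.
Proof.
case: k => [|k].
  by rewrite mul0r subr0 addr0 mul1r fact0 ltW// expR_gt1.
(* For positive arguments the induction runs with the sharper factor k in place of k + 1, which
   makes the bound hold at 0. *)
apply: (@le_trans _ _ (k.+1%:R * expR (1 + (k.+1%:R * ln k.+1%:R - k.+1%:R)))); last first.
  by rewrite ler_wpM2r ?expR_ge0// ler_nat.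
elim: k => [|k IH].
  by rewrite ln1 mulr0 sub0r subrr expR0 mulr1.
rewrite factS natrM ler_wpM2l//; apply: (le_trans IH).
have := @mul_ln_ratio_le k.+2 k.+1%:R; rewrite ltr0n => /(_ isT).
have : (0 : R) < k.+1%:R by rewrite ltr0n.
rewrite -[k.+2%:R]natr1; move: (k.+1%:R : R) => u u0.
rewrite -[X in _ -> X * _ <= _](lnK u0) -expRD ler_expR.
move: (ln (u + 1)) (ln u) => v w.
nra.
Qed.

End UpperBound.

(** * The upper bound, by classes of constant [omega] *)

Section UpperBoundMain.
Local Open Scope ring_scope.
Variables (R : realType) (beta : R).
Hypothesis beta01 : 0 < beta < 1.

(** Here [expR ell] stands for a bound on the harmonic sum. The choice of [z] gives z ell <= k + ell
    and z > k / ell. With Stirling's bound the exponent is then at most 1 + ell + (1 - beta) k (1 +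
    ln t - ln k), and [mul_ln_ratio_le] maximizes the last term over [k]. *)
Lemma upper_term_le (k z : nat) (ell : R) : 0 < ell ->
  z = (Num.truncn (k%:R / ell)).+1 ->
  (k`!%:R / ln 2 ^+ k) `^ beta * (expR ell ^+ z / z%:R ^+ k)
  <= k.+1%:R * expR (1 + ell
       + (1 - beta) * (ell / ln 2 `^ beta) `^ (1 - beta)^-1).
Proof.
move=> l0 zE; have /andP[b0 b1] := beta01.
have c0 := ln2_gt0 R.
have z0 : 0 < z%:R :> R by rewrite zE ltr0n.
have kl0 : 0 <= k%:R / ell by rewrite divr_ge0// ltW.
have /andP[tk kt] := truncn_itv kl0.
have b1' : 1 - beta != 0 by rewrite subr_eq0 gt_eqF.
set t := (ell / ln 2 `^ beta) `^ (1 - beta)^-1.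
have t0 : 0 < t by rewrite powR_gt0 ?divr_gt0 ?powR_gt0.
have lnt : (1 - beta) * ln t = ln ell - beta * ln (ln 2).
  rewrite /t ln_powR ln_div ?posrE ?powR_gt0// ln_powR.
  by rewrite mulrA divff// mul1r.
have cE : ln 2 ^+ k = expR (k%:R * ln (ln 2)) :> R.
  by rewrite expRM_natl lnK.
have fb : (k`!%:R / ln 2 ^+ k) `^ beta <=
    k.+1%:R * expR (1 + beta * (k%:R * ln k%:R - k%:R - k%:R * ln (ln 2))).
  apply: (@le_trans _ _ ((k.+1%:R * expR 1) `^ beta
      * expR (k%:R * ln k%:R - k%:R - k%:R * ln (ln 2)) `^ beta)).
    rewrite -powRM ?mulr_ge0 ?expR_ge0// ge0_ler_powR ?(ltW b0) ?nnegrE//.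
      by rewrite divr_ge0// exprn_ge0// ltW.
    rewrite cE expRB [leRHS]mulrA ler_wpM2r ?invr_ge0 ?expR_ge0//.
    by rewrite -mulrA -expRD fact_le.
  rewrite -expRM expRD mulrA [_ * beta]mulrC ler_wpM2r ?expR_ge0//.
  have e1 : 1 <= expR 1 :> R by rewrite ltW// expR_gt1.
  by rewrite ler1_powR ?(ltW b1)// mulr_ege1// ler1n.
have zkE : z%:R ^+ k = expR (k%:R * ln z%:R) :> R.
  by rewrite expRM_natl lnK.
rewrite zkE -expRN -expRM_natl -expRD.
apply: (le_trans (ler_wpM2r (expR_ge0 _) fb)).
rewrite -mulrA ler_wpM2l// -expRD ler_expR.
have zl : z%:R * ell <= k%:R + ell.
  rewrite -ler_pdivlMr// mulrDl divff ?gt_eqF// zE -natr1 lerD2r.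
  exact: tk.
have kz : k%:R * (ln k%:R - ln ell) <= k%:R * ln z%:R.
  case: (posnP k) => [->|k0]; first by rewrite !mul0r.
  rewrite ler_wpM2l// -ln_div ?posrE ?ltr0n// ler_ln ?posrE ?divr_gt0 ?ltr0n//.
    by rewrite zE ltW.
  by rewrite zE.
have h := mul_ln_ratio_le k t0.
have {}h : (1 - beta) * (k%:R * (1 + ln t - ln k%:R)) <= (1 - beta) * t.
  by rewrite ler_wpM2l// subr_ge0 ltW.
have hE : (1 - beta) * (k%:R * (1 + ln t - ln k%:R)) =
  k%:R * ((1 - beta) - (1 - beta) * ln k%:R + (ln ell - beta * ln (ln 2))).
  by rewrite -lnt; ring.
rewrite hE in h; move: h kz zl; set T := (1 - beta) * t.
move: T (z%:R * ell) (k%:R : R) (ln _) (ln _) (ln _) (ln _) => T u a v w x y.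
lra.
Qed.

(** The weight N / n >= 1 brings in [sum_pow_omega_le]. One factor [K.+1] is the number of classes
    and another comes from [upper_term_le]; each is at most [expR ell / ln 2], whence [ln 2 ^- 2]
    and two of the three [ell]. *)
Lemma sum_G_powR_le (N : nat) (ell : R) : (0 < N)%N -> 0 < ell ->
  1 + ln N%:R <= expR ell ->
  \sum_(1 <= n < N.+1) (G n)%:R `^ beta <= N%:R * (ln 2 ^- 2 *
    expR (1 + 3 * ell + (1 - beta) * (ell / ln 2 `^ beta) `^ (1 - beta)^-1)).
Proof.
move=> N0 l0 Nl; have /andP[b0 b1] := beta01; have c0 := ln2_gt0 R.
set t := (1 - beta) * _.
pose K := trunc_log 2 N.
have Kl : K.+1%:R <= (ln 2)^-1 * expR ell.
  rewrite mulrC ler_pdivlMr//.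
  apply: le_trans Nl; rewrite -natr1 mulrDl mul1r addrC lerD ?ln2_le1//.
  rewrite mulr_natl -lnXn// -natrX ler_ln ?posrE ?ltr0n ?expn_gt0//.
  by rewrite ler_nat trunc_logP.
have H1 : \sum_(1 <= n < N.+1) (G n)%:R `^ beta <=
    N%:R * \sum_(1 <= n < N.+1) ((G n)%:R `^ beta / n%:R).
  rewrite mulr_sumr big_nat [leRHS]big_nat; apply: ler_sum => n /andP[n0 nN].
  rewrite mulrCA ler_peMr ?powR_ge0// ler_pdivlMr ?ltr0n// mul1r ler_nat.
  exact: nN.
apply: (le_trans H1); rewrite ler_wpM2l//.
rewrite big_nat.
have oK n : (1 <= n < N.+1)%N -> (omega n < K.+1)%N.
  move=> /andP[n0 nN]; rewrite ltnS; apply: trunc_log_max => //.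
  exact: leq_trans (omega_le n0) nN.
rewrite (partition_big (fun n => inord (omega n) : 'I_K.+1) xpredT)//=.
apply: (@le_trans _ _ (\sum_(k < K.+1) (K.+1%:R * expR (1 + ell + t)))); last first.
  rewrite sumr_const card_ord -[leLHS]mulr_natl mulrA.
  have -> : 1 + 3 * ell + t = ell + ell + (1 + ell + t) by ring.
  rewrite expRD mulrA ler_wpM2r ?expR_ge0// expRD -exprVn expr2 mulrACA.
  by rewrite ler_pM.
apply: ler_sum => k _.
set z := (Num.truncn (k%:R / ell)).+1.
have kK : k.+1%:R <= K.+1%:R :> R by rewrite ler_nat.
apply: (@le_trans _ _ (k.+1%:R * expR (1 + ell + t))); last first.
  by rewrite ler_wpM2r ?expR_ge0.
apply: le_trans (upper_term_le l0 (erefl z)).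
(* On the class [omega n = k] the weight [z ^ omega n / z ^ k] is 1; the terms of the other classes
   are nonnegative and are added in. *)
apply: (@le_trans _ _ ((k`!%:R / ln 2 ^+ k) `^ beta *
   (\sum_(1 <= n < N.+1) (z ^ omega n)%:R / n%:R / z%:R ^+ k))); last first.
  rewrite ler_wpM2l ?powR_ge0// -mulr_suml ler_wpM2r ?invr_ge0 ?exprn_ge0//.
  apply: (le_trans (sum_pow_omega_le R z N)).
  rewrite lerXn2r ?nnegrE ?harmonic_sum_ge0 ?expR_ge0//.
  exact: le_trans (harmonic_sum_le R N0) Nl.
rewrite mulr_sumr [leRHS]big_nat [leRHS](bigID (fun n => inord (omega n) == k))/=.
rewrite ler_wpDr//.
  by apply: sumr_ge0 => n _; rewrite mulr_ge0 ?powR_ge0// !divr_ge0// exprn_ge0.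
apply: ler_sum => n /andP[nN /eqP nk].
have -> : omega n = k by rewrite -nk inordK// oK.
have /andP[n0 _] := nN.
rewrite natrX mulrAC divff ?expf_neq0 ?pnatr_eq0// mul1r.
rewrite ler_wpM2r ?invr_ge0// ge0_ler_powR ?(ltW b0) ?nnegrE//.
  by rewrite divr_ge0// exprn_ge0// ltW.
have -> : (k : nat) = omega n by rewrite -nk inordK// oK.
exact: G_ub.
Qed.

End UpperBoundMain.
(** * Lower bound *)

Section LowerBound.
Local Open Scope ring_scope.
Variable R : realType.

(** Both sides run over sets of [j + 1] elements with one marked; removing the marked element gives
    [A]. *)
Lemma esym_step (I : finType) (P : {set I}) (u : I -> R) (j : nat) :
  \sum_(A : {set I} | (A \subset P) && (#|A| == j))
     \sum_(i in P :\: A) u i * \prod_(l in A) u l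
  = j.+1%:R * \sum_(A : {set I} | (A \subset P) && (#|A| == j.+1))
                 \prod_(i in A) u i.
Proof.
transitivity (\sum_(A : {set I} | (A \subset P) && (#|A| == j.+1))
    \sum_(i in A) \prod_(l in A) u l); last first.
  rewrite mulr_sumr; apply: eq_bigr => A /andP[_ /eqP cA].
  by rewrite sumr_const cA mulr_natl.
rewrite (exchange_big_dep xpredT)//= [RHS](exchange_big_dep xpredT)//=.
apply: eq_bigr => i _.
rewrite (reindex_onto (fun B => B :\ i) (fun A => i |: A)) /=; last first.
  by move=> A /andP[_ /finset.setDP[_ iA]]; rewrite finset.setU1K.
apply: eq_big => [B|B /andP[_ /eqP BE]]; last first.
  by rewrite -[in RHS]BE big_setU1 ?finset.setD11.
rewrite !inE eqxx /= -andbA; apply/idP/idP.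
  move=> /and3P[/andP[BP /eqP cB] iP /eqP BE].
  rewrite -BE finset.subUset finset.sub1set iP BP cardsU1 finset.setD11 cB add1n eqxx /=.
  by rewrite finset.setU11.
move=> /andP[/andP[BP /eqP cB] iB]; rewrite finset.setD1K// eqxx andbT.
rewrite (fintype.subset_trans _ BP) ?finset.subD1set// (fintype.subsetP BP)// andbT /=.
by move: cB; rewrite (cardsD1 i) iB add1n => -[->].
Qed.

(** In [esym_step], leaving out the [j] elements of [A] costs at most [j * d], so every step gains a
    factor of at least [s]. *)
Lemma esym_ge (I : finType) (P : {set I}) (u : I -> R) (d s : R) (j : nat) :
  (forall i, i \in P -> 0 <= u i <= d) -> 0 <= s -> 0 <= d ->
  s + j%:R * d <= \sum_(i in P) u i ->
  s ^+ j <= j`!%:R *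
    \sum_(A : {set I} | (A \subset P) && (#|A| == j)) \prod_(i in A) u i.
Proof.
move=> ud s0 d0; elim: j => [_|j IH h].
  rewrite expr0 fact0 mul1r (big_pred1 finset.set0) ?big_set0// => A /=.
  by rewrite cards_eq0 andbC; case: eqP => //= ->; rewrite finset.sub0set.
have {}IH : s ^+ j <= j`!%:R *
    \sum_(A : {set I} | (A \subset P) && (#|A| == j)) \prod_(i in A) u i.
  by apply: IH; apply: le_trans h; rewrite lerD2l ler_wpM2r// ler_nat.
rewrite exprSr factS mulnC natrM -mulrA -esym_step.
apply: (le_trans (ler_wpM2r s0 IH)); rewrite -mulrA ler_wpM2l//.
rewrite mulr_suml; apply: ler_sum => A /andP[AP /eqP cA].
have uA : 0 <= \prod_(i in A) u i.
  by apply: prodr_ge0 => i /(fintype.subsetP AP)/ud/andP[].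
rewrite -mulr_suml mulrC ler_wpM2r//.
have : \sum_(i in A) u i <= j%:R * d.
  rewrite -cA mulr_natl -sumr_const; apply: ler_sum => i.
  by move=> /(fintype.subsetP AP)/ud/andP[].
move: h; rewrite (big_setID A)/= (finset.setIidPr AP) -natr1.
by lra.
Qed.

(** * Smooth numbers and Euler's bound for the sum of 1 / p *)

Definition smooth (q n : nat) : bool := all (fun p => p <= q)%N (primes n).

(** A finite stand-in for the Euler product over the primes up to [q]. *)
Definition smooth_sum (q y : nat) : R :=
  \sum_(1 <= n < y.+1 | smooth q n) n%:R^-1.

Lemma smooth_sum_ge0 (q y : nat) : 0 <= smooth_sum q y.
Proof. by apply: sumr_ge0 => n _; rewrite invr_ge0. Qed.

Lemma smooth_sum1 (y : nat) : smooth_sum 1 y <= 1.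
Proof.
rewrite /smooth_sum; case: y => [|y]; first by rewrite big_geq.
rewrite big_ltn_cond// /smooth /= invr1.
rewrite big_nat_cond big1 ?addr0// => n /andP[/andP[n1 _] /allP h].
have := h (pdiv n); rewrite mem_primes pdiv_prime// pdiv_dvd.
rewrite (leq_trans _ n1)// => /(_ isT).
by rewrite leqNgt prime_gt1// pdiv_prime.
Qed.

Lemma smooth_sum_top (y : nat) : smooth_sum y y = harmonic_sum R y.
Proof.
rewrite /smooth_sum /harmonic_sum big_nat_cond [RHS]big_nat_cond.
apply: eq_bigl => n; rewrite andbT andb_idr// => /andP[n0 ny].
apply/allP => p; rewrite mem_primes => /and3P[_ _ /dvdn_leq] /(_ n0) pn.
exact: leq_trans pn ny.
Qed.

Lemma smooth_sum_composite (q y : nat) : ~~ prime q.+1 ->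
  smooth_sum q.+1 y = smooth_sum q y.
Proof.
move=> np; rewrite /smooth_sum; apply: eq_bigl => n; apply: eq_in_all => p.
rewrite mem_primes => /andP[pp _]; rewrite leq_eqVlt ltnS.
by case: eqP => // pq; rewrite pq (negbTE np) in pp.
Qed.

(* Splitting off the multiples of the prime [q + 1] gives
   [A(q+1) <= A(q) + A(q+1) / (q+1)] for the sums [A] over smooth numbers;
   iterating this replaces the Euler product. *)
Lemma smooth_sum_prime (q y : nat) : (0 < q)%N -> prime q.+1 ->
  smooth_sum q.+1 y <= smooth_sum q y * (1 + q%:R^-1).
Proof.
move=> q0 pp; set a := smooth_sum q.+1 y.
have : a <= smooth_sum q y + q.+1%:R^-1 * a.
  rewrite {1}/a /smooth_sum (bigID (fun n => q.+1 %| n)%N)/= addrC lerD//.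
    rewrite big_mkcond [leRHS]big_mkcond/= big_nat [leRHS]big_nat.
    apply: ler_sum => n /andP[n0 _].
    case: ifP => [/andP[/allP h qn]|_]; last by case: ifP; rewrite ?invr_ge0.
    rewrite ifT//; apply/allP => p pn; have := h p pn.
    rewrite leq_eqVlt ltnS => /predU1P[pq|//].
    by move: pn; rewrite mem_primes pq (negbTE qn) !andbF.
  under eq_bigl do rewrite andbC.
  rewrite big_mkcondr sum_multiples//= /a /smooth_sum mulr_sumr.
  rewrite [leRHS]big_mkcond/=.
  have yq : (y %/ q.+1 <= y)%N by apply: leq_div.
  rewrite [leRHS](@big_cat_nat _ _ _ (y %/ q.+1).+1)//= ler_wpDr//.
    by apply: sumr_ge0 => n _; case: ifP.
  rewrite big_nat [leRHS]big_nat; apply: ler_sum => m /andP[m0 _].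
  case: ifP => [/allP h|_]; last first.
    by case: ifP => // _; rewrite mulr_ge0 ?invr_ge0.
  rewrite ifT ?natrM ?invfM//; apply/allP => p pm; apply: h.
  move: pm; rewrite !mem_primes => /and3P[-> _ pm].
  by rewrite muln_gt0 m0 /= dvdn_mull.
have Q0 : (0 : R) < q%:R by rewrite ltr0n.
rewrite -natr1; move: (smooth_sum q y) (q%:R) Q0 => b x x0 h.
have x1 : 0 < x + 1 by rewrite ltr_wpDl// ltW.
have E : a * (x / (x + 1)) = a - (x + 1)^-1 * a by field; rewrite gt_eqF.
have {}h : a * (x / (x + 1)) <= b by rewrite E lerBlDr.
have -> : a = a * (x / (x + 1)) * (1 + x^-1) by field; rewrite !gt_eqF.
by rewrite ler_wpM2r// addr_ge0// invr_ge0 ltW.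
Qed.

(** The factors [1 + q%:R^-1] telescope; at composite numbers the sum stays the same while the bound
    grows. *)
Lemma smooth_sum_le (q y : nat) : (0 < q)%N -> smooth_sum q y <= q%:R.
Proof.
elim: q => [//|[_ _|q IH _]]; first exact: smooth_sum1.
have h := IH isT.
case: (boolP (prime q.+2)) => [pp|np]; last first.
  by rewrite smooth_sum_composite// (le_trans h)// ler_nat.
apply: (le_trans (smooth_sum_prime y _ pp)) => //.
have q0 : (0 : R) < q.+1%:R by rewrite ltr0n.
have -> : q.+2%:R = q.+1%:R * (1 + q.+1%:R^-1) :> R.
  by rewrite mulrDr mulr1 divff ?gt_eqF// natr1.
by rewrite ler_wpM2r// addr_ge0// invr_ge0.
Qed.

Lemma smooth_sum_expR_le (a b y : nat) : (0 < a)%N -> (a <= b)%N ->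
  smooth_sum b y
  <= smooth_sum a y * expR (\sum_(a <= q < b | prime q.+1) q%:R^-1).
Proof.
move=> a0; elim: b => [|b IH]; first by rewrite leqn0 => /eqP a0'; rewrite a0' in a0.
rewrite leq_eqVlt => /predU1P[<-|]; first by rewrite big_geq// expR0 mulr1.
rewrite ltnS => ab; rewrite big_mkcond big_nat_recr//= -big_mkcond/=.
have {}IH := IH ab.
case: (boolP (prime b.+1)) => [pp|np]; last first.
  by rewrite smooth_sum_composite// addr0.
apply: (le_trans (smooth_sum_prime y _ pp)); first exact: leq_trans ab.
by rewrite expRD mulrA ler_pM ?smooth_sum_ge0 ?expR_ge1Dx.
Qed.

(** Every [n <= y] is [y]-smooth, so [ln y.+1%:R] is at most [k%:R] times the exponential of the sum
    of 1 / (p - 1) over the primes k < p <= y. The index [q] is p - 1. *)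
Lemma sum_prime_inv_ge (k y : nat) : (0 < k)%N -> (k <= y)%N ->
  ln (ln y.+1%:R) - ln k%:R - 1
  <= \sum_(k <= q < y | prime q.+1) q.+1%:R^-1 :> R.
Proof.
move=> k0 ky; set S := \sum_(_ <= _ < _ | _) _.
set T : R := \sum_(k <= q < y | prime q.+1) q%:R^-1.
have K0 : (0 : R) < k%:R by rewrite ltr0n.
have L0 : 0 < ln y.+1%:R :> R by rewrite ln_gt0// ltr1n ltnS (leq_trans k0).
(* Passing from 1 / (p - 1) to 1 / p costs a telescoping sum of at most 1 / k. *)
have TS : T <= S + 1.
  have -> : T = S + \sum_(k <= q < y | prime q.+1) (q%:R^-1 - q.+1%:R^-1).
    by rewrite -big_split; apply: eq_bigr => q _; rewrite [RHS]addrC subrK.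
  rewrite lerD2l.
  apply: (@le_trans _ _ (\sum_(k <= q < y) (q%:R^-1 - q.+1%:R^-1))).
    rewrite big_mkcond big_nat [leRHS]big_nat; apply: ler_sum => q /andP[kq _].
    have q0 : (0 < q)%N by apply: leq_trans kq.
    have h : 0 <= q%:R^-1 - q.+1%:R^-1 :> R.
      by rewrite subr_ge0 lef_pV2 ?posrE ?ltr0n// ler_nat.
    by case: ifP.
  rewrite (telescope_sumr_eq (fun i => - i%:R^-1))//; last first.
    by move=> i _; rewrite opprK addrC.
  rewrite opprK addrC lerBlDr (@le_trans _ _ 1)//.
    by rewrite invf_le1// ler1n.
  by rewrite lerDl invr_ge0.
have : ln y.+1%:R <= k%:R * expR T.
  apply: le_trans (harmonic_sum_ge R y) _.
  rewrite -smooth_sum_top; apply: (le_trans (smooth_sum_expR_le y k0 ky)).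
  by rewrite ler_wpM2r ?expR_ge0// smooth_sum_le.
rewrite -ler_ln ?posrE ?mulr_gt0 ?expR_gt0// lnM ?posrE ?expR_gt0// expRK.
move: (ln (ln _)) (ln k%:R) => a b; lra.
Qed.

End LowerBound.

(** * The lower bound, with free parameters [k], [y], [z] and [s] *)

Section LowerBoundMain.
Local Open Scope ring_scope.
Variables (R : realType) (beta : R).
Hypothesis beta01 : 0 < beta < 1.

(** By [G_lb] and [fact_ge] the logarithm of the right side is at least a convex function of k =
    [omega n], up to a constant. It lies above its tangent of slope [ln z]. *)
Lemma G_powR_ge (n : nat) (z : R) : (0 < n)%N -> 0 < z ->
  2^-1 * expR (- (beta * (ln 2 * z `^ beta^-1))) * z ^+ omega n
  <= (G n)%:R `^ beta.
Proof.
move=> n0 z0; have /andP[b0 b1] := beta01; have c0 := ln2_gt0 R.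
set k := omega n.
have w0 : 0 < z `^ beta^-1 by rewrite powR_gt0.
have lw : beta * ln (z `^ beta^-1) = ln z.
  by rewrite ln_powR mulrA divff ?mul1r// gt_eqF.
move: (z `^ beta^-1) w0 lw => w w0 lw.
have Gb : 2^-1 * expR (k%:R * ln k%:R - k%:R - k%:R * ln (ln 2)) <= (G n)%:R :> R.
  apply: le_trans (G_lb R n0); rewrite ler_wpM2l ?invr_ge0//.
  rewrite expRB -/k expRM_natl lnK// ler_wpM2r ?invr_ge0 ?exprn_ge0 ?(ltW c0)//.
  exact: fact_ge.
apply: (@le_trans _ _
   ((2^-1 * expR (k%:R * ln k%:R - k%:R - k%:R * ln (ln 2))) `^ beta)); last first.
  by rewrite ge0_ler_powR ?(ltW b0) ?nnegrE// mulr_ge0 ?invr_ge0 ?expR_ge0.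
rewrite powRM ?invr_ge0 ?expR_ge0// -mulrA ler_pM ?invr_ge0//.
- by rewrite mulr_ge0 ?expR_ge0// exprn_ge0// ltW.
- by rewrite ger1_powR ?(ltW b1)// invr_gt0 ltr0n /= invf_le1// ler1n.
rewrite -[z in z ^+ _](lnK z0) -expRM_natl -expRD -expRM ler_expR.
(* The point of tangency is [ln 2 * w], where [beta * ln w = ln z]. *)
have h := mul_ln_ratio_le k (mulr_gt0 c0 w0).
rewrite lnM ?posrE// in h.
have : beta * (k%:R * (1 + (ln (ln 2) + ln w) - ln k%:R)) <= beta * (ln 2 * w).
  by rewrite ler_wpM2l// ltW.
have -> : beta * (k%:R * (1 + (ln (ln 2) + ln w) - ln k%:R)) =
   k%:R * (beta * ln w) + beta * (k%:R * (1 + ln (ln 2) - ln k%:R)) by ring.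
rewrite lw; move: (beta * (ln 2 * w)) (k%:R : R) (ln z) (ln (ln 2)) (ln _) => t x l m p.
lra.
Qed.

(** One term of the binomial expansion of [(1 + (z - 1)) ^+ w]. *)
Lemma bin_le_expr (z : R) (w k : nat) : 1 <= z ->
  (z - 1) ^+ k * 'C(w, k)%:R <= z ^+ w.
Proof.
move=> z1; have z10 : 0 <= z - 1 by rewrite subr_ge0.
case: (leqP k w) => [kw|wk]; last first.
  by rewrite bin_small// mulr0 exprn_ge0// (le_trans _ z1).
have zE : z = 1 + (z - 1) by rewrite addrC subrK.
rewrite [in leRHS]zE [leRHS]exprDn (bigD1 (Ordinal (kw : (k < w.+1)%N)))//=.
rewrite expr1n mul1r mulr_natr lerDl sumr_ge0// => i _.
by rewrite mulrn_wge0// mulr_ge0// ?exprn_ge0// ler01.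
Qed.

Definition prime_window (k y : nat) : {set 'I_y.+1} :=
  [set p : 'I_y.+1 | prime p && (k < p)%N].

Lemma sum_prime_window (k y : nat) :
  \sum_(p in prime_window k y) (p : nat)%:R^-1
  = \sum_(k <= q < y | prime q.+1) q.+1%:R^-1 :> R.
Proof.
transitivity (\sum_(k.+1 <= p < y.+1 | prime p) p%:R^-1 : R).
  by rewrite big_geq_mkord; apply: eq_bigl => p; rewrite inE.
by rewrite big_add1.
Qed.

Lemma prod_prime_window_dvd (k y n : nat) (A : {set 'I_y.+1}) : (0 < n)%N ->
  A \subset prime_window k y -> (\prod_(p in A) (p : nat) %| n)%N ->
  {in A, forall p : 'I_y.+1, val p \in primes n}.
Proof.
move=> n0 /fintype.subsetP AP An p pA; have := AP p pA.
rewrite inE => /andP[pp _]; rewrite mem_primes pp n0 /=.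
by apply: dvdn_trans An; rewrite (bigD1 p)//= dvdn_mulr.
Qed.

Lemma count_prime_subsets (k y j n : nat) : (0 < n)%N ->
  (\sum_(A : {set 'I_y.+1} | (A \subset prime_window k y) && (#|A| == j))
     (\prod_(p in A) (p : nat) %| n) <= 'C(omega n, j))%N.
Proof.
move=> n0; pose Q := [set p : 'I_y.+1 | val p \in primes n].
have Qn : (#|Q| <= omega n)%N.
  rewrite /omega cardE -(size_map val).
  apply: uniq_leq_size; first by rewrite map_inj_uniq ?enum_uniq//; exact: val_inj.
  by move=> q /mapP[p]; rewrite mem_enum inE => pn ->.
apply: leq_trans (leq_bin2l _ Qn).
rewrite -cards_draws -sum1_card [leqRHS]big_mkcond [leqLHS]big_mkcond /=.
apply: leq_sum => A _; case: ifP => // /andP[AP cA].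
case: (boolP (_ %| _)%N) => // An /=; rewrite ifT// inE cA andbT.
apply/fintype.subsetP => p pA; rewrite inE.
exact: (prod_prime_window_dvd n0 AP An).
Qed.

Lemma sum_pow_omega_ge (N k y : nat) (z s : R) :
  (0 < k)%N -> (k <= y)%N -> (y ^ k <= N)%N -> 1 <= z -> 0 <= s ->
  s + ln k%:R + 2 <= ln (ln y.+1%:R) ->
  (z - 1) ^+ k * (N%:R / 2 * (s ^+ k / k`!%:R))
  <= \sum_(1 <= n < N.+1) z ^+ omega n.
Proof.
move=> k0 ky yN z1 s0 sy; have z10 : 0 <= z - 1 by rewrite subr_ge0.
have K0 : (0 : R) < k%:R by rewrite ltr0n.
pose P := prime_window k y.
have E : s ^+ k <= k`!%:R * \sum_(A : {set 'I_y.+1} | (A \subset P) && (#|A| == k))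
    \prod_(p in A) (p : nat)%:R^-1.
  (* The primes exceed [k], so [d = 1 / k] works and the loss [k * d] is 1. Together with the 1 lost
     in [sum_prime_inv_ge] this is the 2 in the hypothesis on [s]. *)
  apply: (@esym_ge R _ _ _ k%:R^-1) => //; rewrite ?invr_ge0//.
    move=> p; rewrite inE invr_ge0 ler0n => /andP[_ kp] /=.
    by rewrite lef_pV2 ?posrE ?ltr0n ?(leq_trans _ kp)// ler_nat ltnW.
  rewrite divff ?gt_eqF// sum_prime_window.
  by apply: le_trans (sum_prime_inv_ge R k0 ky); lra.
apply: (@le_trans _ _ ((z - 1) ^+ k * \sum_(1 <= n < N.+1) 'C(omega n, k)%:R)).
  2: by rewrite mulr_sumr; apply: ler_sum => n _; exact: bin_le_expr.
rewrite ler_wpM2l ?exprn_ge0//.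
apply: (@le_trans _ _ (\sum_(1 <= n < N.+1)
  \sum_(A : {set 'I_y.+1} | (A \subset P) && (#|A| == k))
     (\prod_(p in A) (p : nat) %| n)%N%:R)); last first.
  rewrite big_nat [leRHS]big_nat; apply: ler_sum => n /andP[n0 _].
  by rewrite -natr_sum ler_nat count_prime_subsets.
rewrite exchange_big/=.
have f0 : (0 : R) < k`!%:R by rewrite ltr0n fact_gt0.
apply: (@le_trans _ _ (N%:R / 2 *
    \sum_(A : {set 'I_y.+1} | (A \subset P) && (#|A| == k))
    \prod_(p in A) (p : nat)%:R^-1)).
  by rewrite ler_wpM2l ?divr_ge0// ler_pdivrMr// mulrC.
rewrite mulr_sumr; apply: ler_sum => A /andP[/fintype.subsetP AP /eqP cA].
set D := (\prod_(p in A) (p : nat))%N.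
have D0 : (0 < D)%N.
  by apply: prodn_cond_gt0 => p /AP; rewrite inE => /andP[/prime_gt0].
(* Hence [N %/ D] is at least 1, and so at least half of N / D. *)
have DN : (D <= N)%N.
  apply: leq_trans yN; rewrite -cA -prod_nat_const; apply: leq_prod => p _.
  by rewrite -ltnS.
have -> : \prod_(p in A) (p : nat)%:R^-1 = D%:R^-1 :> R.
  by rewrite prodfV -natr_prod.
rewrite -natr_sum -big_mkcond/= sum_multiples// sum_nat_const_nat subn1 muln1 /=.
rewrite mulrAC ler_pdivrMr// ler_pdivrMr ?ltr0n// -!natrM ler_nat.
have := ltn_ceil N D0; have : (0 < N %/ D)%N by rewrite divn_gt0.
move: (N %/ D)%N => q; nia.
Qed.

Lemma sum_G_powR_ge (N k y : nat) (z s : R) :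
  (0 < k)%N -> (k <= y)%N -> (y ^ k <= N)%N -> 1 <= z -> 0 <= s ->
  s + ln k%:R + 2 <= ln (ln y.+1%:R) ->
  2^-1 * expR (- (beta * (ln 2 * z `^ beta^-1))) *
  ((z - 1) ^+ k * (N%:R / 2 * (s ^+ k / k`!%:R)))
  <= \sum_(1 <= n < N.+1) (G n)%:R `^ beta.
Proof.
move=> k0 ky yN z1 s0 sy.
have z0 : 0 < z by apply: lt_le_trans z1.
apply: le_trans (ler_wpM2l _ (sum_pow_omega_ge k0 ky yN z1 s0 sy)) _.
  by rewrite mulr_ge0 ?invr_ge0 ?expR_ge0.
rewrite mulr_sumr big_nat [leRHS]big_nat; apply: ler_sum => n /andP[n0 _].
exact: G_powR_ge.
Qed.

End LowerBoundMain.
(** * Asymptotics *)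

Section Asymptotics.
Local Open Scope ring_scope.
Variables (R : realType) (beta : R).
Hypothesis beta01 : 0 < beta < 1.

(* In terms of [l = ln (ln x)], [saddle_z l] is the exponent base that optimizes
   the lower bound and [(1 - beta) * saddle_t l] is the main term. *)
Definition saddle_z (l : R) : R := (l / ln 2) `^ (beta / (1 - beta)).

Definition saddle_t (l : R) : R := saddle_z l * l.

Lemma saddle_tE (l : R) : 0 < l ->
  saddle_t l = (ln 2 `^ (beta / (1 - beta)))^-1 * l `^ (1 - beta)^-1.
Proof.
move=> l0; have /andP[b0 b1] := beta01; have c0 := ln2_gt0 R.
have b1' : 1 - beta != 0 by rewrite subr_eq0 gt_eqF.
rewrite /saddle_t /saddle_z powRM ?(ltW l0) ?invr_ge0 ?(ltW c0)//.
rewrite -(powR_inv1 (ltW c0)) -powRrM mulN1r powRN mulrC mulrA.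
rewrite -{1}[l]powRr1 ?(ltW l0)// -powRD; last by rewrite (gt_eqF l0) implybT.
rewrite mulrC; congr (_ * _ `^ _).
by field.
Qed.

(** This turns the loss in the exponent of [G_powR_ge] into [beta * saddle_t l]. *)
Lemma saddle_t_powR (l : R) : 0 < l ->
  ln 2 * saddle_z l `^ beta^-1 = saddle_t l.
Proof.
move=> l0; have /andP[b0 b1] := beta01; have c0 := ln2_gt0 R.
have b1' : 1 - beta != 0 by rewrite subr_eq0 gt_eqF.
have b0' : beta != 0 by rewrite gt_eqF.
have lc0 : 0 < l / ln 2 by rewrite divr_gt0.
have -> : saddle_t l = ln 2 * (saddle_z l * (l / ln 2)).
  by rewrite /saddle_t; field; rewrite gt_eqF.
congr (_ * _); rewrite /saddle_z -powRrM.
rewrite -[X in _ = _ * X]powRr1 ?(ltW lc0)// -powRD; last first.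
  by rewrite (gt_eqF lc0) implybT.
by congr (_ `^ _); field; rewrite b0' b1'.
Qed.

Definition G_sum (x : R) : R :=
  \sum_(1 <= n < (Num.truncn x).+1) ((G n)%:R : R) `^ beta.

(** The bound is applied with [ell = l + 1], as 1 + ln N <= 2 ln x <= exp (l + 1). The shift turns 1
    + 3 ell into 4 + 3 l, and its factor (1 + 1 / l)^(1 / (1 - beta)) is bounded by an
    exponential. *)
Lemma G_sum_le (x l : R) : 1 < ln x -> l = ln (ln x) ->
  (G_sum x <= x * expR (4 - 2 * ln (ln 2) + 3 * l
     + (1 - beta) * (saddle_t l * expR ((1 - beta)^-1 / l))))%R.
Proof.
move=> lnx1 lE; have /andP[b0 b1] := beta01; have c0 := ln2_gt0 R.
have b1' : 1 - beta != 0 by rewrite subr_eq0 gt_eqF.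
have l0 : 0 < l by rewrite lE ln_gt0.
have x1 : 1 < x.
  rewrite ltNge; apply/negP => /ln_le0; apply/negP; rewrite -ltNge.
  exact: lt_trans lnx1.
have x0 : 0 < x by apply: lt_trans x1.
have N0 : (0 < Num.truncn x)%N by rewrite truncn_gt0 ltW.
have /andP[Nx _] := truncn_itv (ltW x0).
have ell0 : 0 < l + 1 by rewrite addr_gt0.
have Nl : 1 + ln (Num.truncn x)%:R <= expR (l + 1).
  rewrite expRD {1}lE lnK ?posrE ?(lt_trans _ lnx1)//.
  have lnN : ln (Num.truncn x)%:R <= ln x by rewrite ler_ln ?posrE// ltr0n.
  have e2 : 1 + 1 <= expR 1 :> R by exact: expR_ge1Dx.
  nra.
apply: (le_trans (sum_G_powR_le beta01 N0 ell0 Nl)).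
rewrite ler_pM//.
  by rewrite mulr_ge0 ?expR_ge0// invr_ge0 exprn_ge0// ltW.
have -> : ln 2 ^- 2 = expR (- (2 * ln (ln 2))) :> R.
  by rewrite expRN expRM_natl lnK.
rewrite -expRD ler_expR.
suff h : ((l + 1) / ln 2 `^ beta) `^ (1 - beta)^-1 <=
    saddle_t l * expR ((1 - beta)^-1 / l).
  have : (1 - beta) * ((l + 1) / ln 2 `^ beta) `^ (1 - beta)^-1 <=
    (1 - beta) * (saddle_t l * expR ((1 - beta)^-1 / l)).
    by rewrite ler_wpM2l// subr_ge0 ltW.
  lra.
rewrite saddle_tE// powRM ?invr_ge0 ?powR_ge0 ?(ltW ell0)//.
rewrite -(powR_inv1 (powR_ge0 (ln 2) beta)) -!powRrM.
rewrite [leLHS]mulrC.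
have -> : beta * (-1 / (1 - beta)) = - (beta / (1 - beta)) by ring.
rewrite powRN -[leRHS]mulrA.
rewrite ler_wpM2l ?invr_ge0 ?powR_ge0//.
have -> : l + 1 = l * (1 + l^-1) by rewrite mulrDr mulr1 divff// gt_eqF.
have li0 : 0 < l^-1 by rewrite invr_gt0.
rewrite powRM ?(ltW l0)//; last by rewrite addr_ge0// ltW.
rewrite ler_wpM2l ?powR_ge0//.
rewrite [leLHS]/powR gt_eqF ?addr_gt0// ler_expR.
rewrite ler_wpM2l ?invr_ge0 ?subr_ge0 ?(ltW b1)//.
by apply: le_ln1Dx; apply: lt_trans li0; rewrite ltrN10.
Qed.

(** The parameters are k = floor t, y = floor (x^(1 / k)) and z = [saddle_z l]. In [s], one [ln t]
    absorbs the division in ln (ln x / k) and the other the term ln k of [sum_G_powR_ge]. The main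
    factor is (q t)^k / k!. *)
Lemma G_sum_ge (x l t s q : R) : 1 < ln x -> l = ln (ln x) ->
  t = saddle_t l -> s = l - 2 * ln t - 2 ->
  q = (saddle_z l - 1) * s / t ->
  1 <= t -> 1 < saddle_z l -> 0 < s -> - 1 <= ln q ->
  x * expR (- 5 - ln t - beta * t + (t - 1) * (1 + ln q)) <= G_sum x.
Proof.
move=> lnx1 lE tE sE qE t1 z1 s0 q1.
have /andP[b0 b1] := beta01; have c0 := ln2_gt0 R.
have l0 : 0 < l by rewrite lE ln_gt0.
have lnx0 : 0 < ln x by apply: lt_trans lnx1.
have x1 : 1 < x.
  rewrite ltNge; apply/negP => /ln_le0; apply/negP; rewrite -ltNge.
  exact: lt_trans lnx1.
have x0 : 0 < x by apply: lt_trans x1.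
have t0 : 0 < t by apply: lt_le_trans t1.
set N := Num.truncn x.
set k := Num.truncn t.
have k0 : (0 < k)%N by rewrite truncn_gt0.
have /andP[kt tk] := truncn_itv (ltW t0); rewrite -/k in kt tk.
have K0 : 0 < k%:R :> R by rewrite ltr0n.
have lnkt : ln k%:R <= ln t by rewrite ler_ln.
have lnt0 : 0 <= ln t by rewrite ln_ge0.
set y := Num.truncn (expR (ln x / k%:R)).
have y1 : expR (ln x / k%:R) < y.+1%:R.
  by have /andP[] := truncn_itv (expR_ge0 (ln x / k%:R)).
have yle : y%:R <= expR (ln x / k%:R).
  by have /andP[] := truncn_itv (expR_ge0 (ln x / k%:R)).
have lnxE : ln x = expR l by rewrite lE lnK// posrE.
(* Positivity of [s] gives 2 ln t < l; the bound is what yields [k <= y]. *)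
have kk : k%:R * k%:R <= ln x.
  rewrite lnxE -(lnK K0) -expRD ler_expR.
  by move: s0; rewrite sE; move: lnkt; move: (ln k%:R) (ln t) => a b; lra.
have ky : (k <= y)%N.
  rewrite truncn_ge_nat ?expR_ge0//; apply: (@le_trans _ _ (expR k%:R)).
    by apply: le_trans (expR_ge1Dx _); rewrite lerDr.
  by rewrite ler_expR ler_pdivlMr.
have yN : (y ^ k <= N)%N.
  rewrite truncn_ge_nat ?(ltW x0)// natrX.
  apply: (@le_trans _ _ (expR (ln x / k%:R) ^+ k)).
    by rewrite lerXn2r ?nnegrE ?expR_ge0.
  by rewrite -expRM_natr divfK ?gt_eqF// lnK.
have sy : s + ln k%:R + 2 <= ln (ln y.+1%:R).
  have h : ln x / k%:R <= ln y.+1%:R.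
    by rewrite -ler_expR lnK ?posrE ?ltr0n// ltW.
  have : ln (ln x / k%:R) <= ln (ln y.+1%:R).
    by rewrite ler_ln// posrE ?divr_gt0// (lt_le_trans _ h)// divr_gt0.
  rewrite ln_div ?posrE// -lE sE; move: lnkt.
  by move: (ln k%:R) (ln t) (ln (ln y.+1%:R)) => a b d; lra.
have := sum_G_powR_ge beta01 k0 ky yN (ltW z1) (ltW s0) sy.
apply: le_trans; rewrite saddle_t_powR// -tE.
have z10 : 0 < saddle_z l - 1 by rewrite subr_gt0.
have q0 : 0 < q by rewrite qE divr_gt0 ?mulr_gt0.
have zs : (saddle_z l - 1) * s = q * t by rewrite qE divfK// gt_eqF.
have -> : 2^-1 * expR (- (beta * t)) *
    ((saddle_z l - 1) ^+ k * (N%:R / 2 * (s ^+ k / k`!%:R))) =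
    (2^-1 * N%:R) * (2^-1 * expR (- (beta * t)) * ((q * t) ^+ k / k`!%:R)).
  by rewrite -zs exprMn; ring.
have Nx : x * 2^-1 <= N%:R.
  have /andP[] := truncn_itv (ltW x0); rewrite -/N -natr1 => _.
  have : 1 <= N%:R :> R by rewrite ler1n truncn_gt0 ltW.
  move: (N%:R : R) => n; lra.
apply: (@le_trans _ _ ((2^-1 * (x * 2^-1)) *
   (2^-1 * expR (- (beta * t)) * ((q * t) ^+ k / k`!%:R)))); last first.
  rewrite ler_wpM2r//.
    rewrite !mulr_ge0 ?invr_ge0 ?expR_ge0// exprn_ge0// mulr_ge0//; exact: ltW.
  by rewrite ler_wpM2l.
have -> : 2^-1 * (x * 2^-1) * (2^-1 * expR (- (beta * t)) * ((q * t) ^+ k / k`!%:R))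
  = x * (2^-1 ^+ 3 * expR (- (beta * t)) * ((q * t) ^+ k / k`!%:R)) by ring.
rewrite ler_wpM2l ?(ltW x0)//.
(* The three halves come from [G_powR_ge], from [sum_pow_omega_ge] and from N >= x / 2. *)
have h2 : expR (- 3) <= 2^-1 ^+ 3 :> R.
  rewrite exprVn expRN lef_pV2 ?posrE ?expR_gt0 ?exprn_gt0//.
  rewrite -[3]mulr1 expRM_natl lerXn2r ?nnegrE ?expR_ge0//.
  by have := expR_ge1Dx (1 : R).
have hq : expR (k%:R * (ln q + ln t)) = (q * t) ^+ k.
  by rewrite -lnM ?posrE// expRM_natl lnK// posrE mulr_gt0.
(* This is [fact_le] with k + 1 <= 2 t <= e t and ln k <= ln t. *)
have hf : expR (- (ln t + 1) - (1 + (k%:R * ln t - k%:R))) <= (k`!%:R)^-1.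
  rewrite -opprD expRN lef_pV2 ?posrE ?expR_gt0 ?ltr0n ?fact_gt0//.
  apply: (le_trans (fact_le R k)); rewrite [leRHS]expRD ler_pM ?expR_ge0//.
    rewrite expRD lnK ?posrE//; have := expR_ge1Dx (1 : R).
    rewrite -natr1; move: (k%:R : R) kt (expR 1) => a akt e he; nra.
  by rewrite ler_expR lerD2l lerD2r ler_wpM2l.
have h3 : expR (- 3) * expR (- (beta * t)) * (expR (k%:R * (ln q + ln t)) *
   expR (- (ln t + 1) - (1 + (k%:R * ln t - k%:R)))) <=
   2^-1 ^+ 3 * expR (- (beta * t)) * ((q * t) ^+ k / k`!%:R).
  rewrite hq ler_pM ?mulr_ge0 ?expR_ge0 ?ler_wpM2r ?expR_ge0//.
    by rewrite exprn_ge0// mulr_ge0// ltW.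
  by rewrite ler_wpM2l// exprn_ge0// mulr_ge0// ltW.
apply: le_trans h3; rewrite -!expRD ler_expR.
move: tk; rewrite -natr1.
(* The sign allows [k] to be replaced by the smaller [t - 1]. *)
have : 0 <= 1 + ln q by lra.
move: (ln q) (ln t) (beta * t) (k%:R : R) => a b d k' a0 tk.
nra.
Qed.

End Asymptotics.

(** * Limits at infinity of the saddle point quantities and of the error terms *)

Section Limits.
Local Open Scope classical_set_scope.
Local Open Scope ring_scope.
Variable R : realType.

Lemma cvg_inv_pinfty : x^-1 @[x --> (+oo : set_system R)] --> (0 : R).
Proof.
apply: (gtr0_cvgV0 (f := id) _).2; first exact: nbhs_pinfty_gt.
exact: cvg_id.
Qed.

Lemma cvg_ln_pinfty : ln x @[x --> (+oo : set_system R)] --> +oo.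
Proof.
apply/cvgryPge => a; near=> x.
have x0 : 0 < x by near: x; exact: nbhs_pinfty_gt.
have ax : expR a <= x by near: x; exact: nbhs_pinfty_ge.
by rewrite -(expRK a) ler_ln ?posrE ?expR_gt0.
Unshelve. all: by end_near. Qed.

Lemma cvg_powR_pinfty (a : R) : 0 < a ->
  x `^ a @[x --> (+oo : set_system R)] --> +oo.
Proof.
move=> a0; apply/cvgryPge => b; near=> x.
have x0 : 0 < x by near: x; exact: nbhs_pinfty_gt.
rewrite /powR gt_eqF//; apply: le_trans (expR_ge1Dx _).
rewrite -lerBlDl -ler_pdivrMl//.
near: x; apply: (cvgryPge _).1; exact: cvg_ln_pinfty.
Unshelve. all: by end_near. Qed.

(** With s the square root of x, ln x = 2 ln s <= 2 s. *)
Lemma cvg_ln_div_pinfty : ln x / x @[x --> (+oo : set_system R)] --> (0 : R).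
Proof.
apply: (@squeeze_cvgr _ _ _ _ (fun=> 0) (fun x => 2 * (x `^ 2^-1)^-1)).
- near=> x.
  have x1 : 1 <= x by near: x; exact: nbhs_pinfty_ge.
  have x0 : 0 < x by apply: lt_le_trans x1.
  rewrite divr_ge0 ?ln_ge0 ?(ltW x0)//= ler_pdivrMr//.
  have sx : 0 < x `^ 2^-1 by rewrite powR_gt0.
  have xE : x = x `^ 2^-1 * x `^ 2^-1 :> R.
    rewrite -powRD; last by rewrite (gt_eqF x0) implybT.
    by rewrite -{1}(powRr1 (ltW x0)); congr (_ `^ _); field.
  move: (x `^ 2^-1) sx xE => s s0 ->.
  rewrite lnM ?posrE// mulrA divfK ?gt_eqF// mulrDl mul1r.
  by rewrite lerD// ltW// ln_sublinear.
- exact: cvg_cst.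
- rewrite -(mulr0 2); apply: cvgMr.
  apply: (cvg_comp (fun x : R => x `^ 2^-1) GRing.inv _ cvg_inv_pinfty).
  by apply: cvg_powR_pinfty; rewrite invr_gt0.
Unshelve. all: by end_near. Qed.

Variable beta : R.
Hypothesis beta01 : 0 < beta < 1.

Let b_gt0 : 0 < beta / (1 - beta).
Proof. by have /andP[b0 b1] := beta01; rewrite divr_gt0// subr_gt0. Qed.

Lemma cvg_saddle_z : saddle_z beta l @[l --> (+oo : set_system R)] --> +oo.
Proof.
have c0 := ln2_gt0 R.
apply: (cvg_comp (fun l : R => l / ln 2) (fun y => y `^ (beta / (1 - beta)))).
  apply/cvgryPge => a; near=> x.
  have ax : a * ln 2 <= x by near: x; apply: nbhs_pinfty_ge; rewrite num_real.
  by rewrite ler_pdivlMr.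
exact: cvg_powR_pinfty.
Unshelve. all: by end_near. Qed.

Lemma cvg_saddle_t : saddle_t beta l @[l --> (+oo : set_system R)] --> +oo.
Proof.
apply/cvgryPge => a; near=> l; rewrite /saddle_t.
have z1 : 1 <= saddle_z beta l.
  by near: l; apply: (cvgryPge _).1; exact: cvg_saddle_z.
have l0 : 0 <= l by near: l; exact: nbhs_pinfty_ge.
apply: (@le_trans _ _ l); last by rewrite ler_peMl.
by near: l; apply: nbhs_pinfty_ge; rewrite num_real.
Unshelve. all: by end_near. Qed.

Lemma cvg_saddle_zV : (saddle_z beta l)^-1 @[l --> (+oo : set_system R)] --> (0 : R).
Proof. exact: cvg_comp cvg_saddle_z cvg_inv_pinfty. Qed.

Lemma cvg_saddle_tV : (saddle_t beta l)^-1 @[l --> (+oo : set_system R)] --> (0 : R).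
Proof. exact: cvg_comp cvg_saddle_t cvg_inv_pinfty. Qed.

Lemma cvg_ln_saddle_t :
  ln (saddle_t beta l) / l @[l --> (+oo : set_system R)] --> (0 : R).
Proof.
have c0 := ln2_gt0 R; set b := beta / (1 - beta).
have h : (b + 1) * (ln l / l) - b * ln (ln 2) * l^-1
    @[l --> (+oo : set_system R)] --> (b + 1) * 0 - b * ln (ln 2) * (0 : R).
  apply: cvgB; apply: cvgMr; [exact: cvg_ln_div_pinfty|exact: cvg_inv_pinfty].
rewrite !mulr0 subr0 in h; apply: cvg_trans h; apply: near_eq_cvg; near=> l.
have l0 : 0 < l by near: l; exact: nbhs_pinfty_gt.
rewrite /saddle_t /saddle_z lnM ?posrE ?powR_gt0 ?divr_gt0//.
by rewrite ln_powR ln_div ?posrE// -/b; ring.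
Unshelve. all: by end_near. Qed.

(** The number [q] of [G_sum_ge] as a function of [l]. *)
Definition saddle_ratio (l : R) : R := (saddle_z beta l - 1)
  * (l - 2 * ln (saddle_t beta l) - 2) / saddle_t beta l.

Lemma cvg_saddle_ratio :
  saddle_ratio l @[l --> (+oo : set_system R)] --> (1 : R).
Proof.
have h : (1 - (saddle_z beta l)^-1) *
    (1 - 2 * (ln (saddle_t beta l) / l) - 2 * l^-1)
    @[l --> (+oo : set_system R)] --> (1 - 0) * (1 - 2 * 0 - 2 * (0 : R)).
  apply: cvgM.
    by apply: cvgB; [exact: cvg_cst|exact: cvg_saddle_zV].
  apply: cvgB; last by apply: cvgMr; exact: cvg_inv_pinfty.
  apply: cvgB; first exact: cvg_cst.
  by apply: cvgMr; exact: cvg_ln_saddle_t.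
rewrite !mulr0 !subr0 mulr1 in h; apply: cvg_trans h.
apply: near_eq_cvg; near=> l.
have l0 : 0 < l by near: l; exact: nbhs_pinfty_gt.
have z0 : 0 < saddle_z beta l by rewrite powR_gt0// divr_gt0// ln2_gt0.
rewrite /saddle_ratio; move: (ln _) => a; rewrite /saddle_t.
by field; rewrite !gt_eqF.
Unshelve. all: by end_near. Qed.

(** The upper bound for the error [eps]. The term in [l] is negligible because l / t is 1 / z, with
    t and z the saddle quantities. *)
Lemma cvg_upper (C : R) :
  (C + 3 * l + (1 - beta) * (saddle_t beta l * expR ((1 - beta)^-1 / l)))
    / ((1 - beta) * saddle_t beta l) - 1
  @[l --> (+oo : set_system R)] --> (0 : R).
Proof.
have /andP[b0 b1] := beta01.
have b1' : 1 - beta != 0 by rewrite subr_eq0 gt_eqF.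
have h : (C / (1 - beta)) * (saddle_t beta l)^-1
    + (3 / (1 - beta)) * (saddle_z beta l)^-1
    + expR ((1 - beta)^-1 * l^-1) - 1
    @[l --> (+oo : set_system R)] -->
    (C / (1 - beta)) * 0 + (3 / (1 - beta)) * 0
      + expR ((1 - beta)^-1 * 0) - (1 : R).
  apply: cvgB; last exact: cvg_cst.
  apply: cvgD.
    by apply: cvgD; apply: cvgMr; [exact: cvg_saddle_tV|exact: cvg_saddle_zV].
  apply: (@continuous_cvg _ _ _ _ _ (fun l : R => (1 - beta)^-1 * l^-1)).
    exact: continuous_expR.
  by apply: cvgMr; exact: cvg_inv_pinfty.
rewrite !mulr0 !add0r expR0 subrr in h; apply: cvg_trans h.
apply: near_eq_cvg; near=> l.
have l0 : 0 < l by near: l; exact: nbhs_pinfty_gt.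
have z0 : 0 < saddle_z beta l by rewrite powR_gt0// divr_gt0// ln2_gt0.
move: (expR _) => e; rewrite /saddle_t.
by field; rewrite !gt_eqF ?subr_gt0.
Unshelve. all: by end_near. Qed.

(** The lower bound for [eps]. As [saddle_ratio] tends to 1, its logarithm vanishes in the limit and
    - beta t + t is left as the main term. *)
Lemma cvg_lower :
  (- 5 - ln (saddle_t beta l) - beta * saddle_t beta l
     + (saddle_t beta l - 1) * (1 + ln (saddle_ratio l)))
    / ((1 - beta) * saddle_t beta l) - 1
  @[l --> (+oo : set_system R)] --> (0 : R).
Proof.
have /andP[b0 b1] := beta01.
have b1' : 1 - beta != 0 by rewrite subr_eq0 gt_eqF.
have h : (1 - beta)^-1 * (- (5 * (saddle_t beta l)^-1)
      - ln (saddle_t beta l) / saddle_t beta l - beta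
      + (1 - (saddle_t beta l)^-1) * (1 + ln (saddle_ratio l))) - 1
    @[l --> (+oo : set_system R)] -->
    (1 - beta)^-1 * (- (5 * 0) - 0 - beta + (1 - 0) * (1 + ln 1)) - (1 : R).
  apply: cvgB; last exact: cvg_cst.
  apply: cvgMr; apply: cvgD.
    apply: cvgB; last exact: cvg_cst.
    apply: cvgB; first by apply: cvgN; apply: cvgMr; exact: cvg_saddle_tV.
    exact: (cvg_comp _ (fun y : R => ln y / y) cvg_saddle_t cvg_ln_div_pinfty).
  apply: cvgM; first by apply: cvgB; [exact: cvg_cst|exact: cvg_saddle_tV].
  apply: cvgD; first exact: cvg_cst.
  apply: (@continuous_cvg _ _ _ _ _ saddle_ratio (@ln R)).
    exact: continuous_ln.
  exact: cvg_saddle_ratio.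
rewrite ln1 mulr0 oppr0 !addr0 add0r mulr1 [- beta + 1]addrC in h.
rewrite mulVf// subrr in h; apply: cvg_trans h.
apply: near_eq_cvg; near=> l.
have t0 : 0 < saddle_t beta l.
  by near: l; apply: (cvgryPgt _).1; exact: cvg_saddle_t.
move: (ln _) (ln _) => x y.
by field; rewrite !gt_eqF ?subr_gt0.
Unshelve. all: by end_near. Qed.

End Limits.

(** * The asymptotic formula, by squeezing the error term *)

Local Open Scope classical_set_scope.
Local Open Scope ring_scope.

Theorem theorem1p8 (R : realType) (beta : R) (hbeta : 0 < beta < 1) :
  exists eps : R -> R,
    eps x @[x --> +oo] --> 0 /\
    \forall x \near +oo,
      \sum_(1 <= n < (Num.truncn x).+1) ((G n)%:R : R) `^ beta
      = x * expR ((1 + eps x)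
                  * ((1 - beta) / (ln 2 `^ (beta / (1 - beta)))
                     * iter_ln 2 x `^ (1 / (1 - beta)))).
Proof.
pose l (x : R) := ln (ln x).
pose M (x : R) := (1 - beta) * saddle_t beta (l x).
have /andP[b0 b1] := hbeta.
have l_oo : l x @[x --> (+oo : set_system R)] --> +oo.
  exact: cvg_comp (@cvg_ln_pinfty R) (@cvg_ln_pinfty R).
have near_l (P : R -> Prop) : (\forall y \near (+oo : set_system R), P y) ->
    \forall x \near (+oo : set_system R), P (l x).
  by move=> h; exact: l_oo.
have MP : \forall x \near (+oo : set_system R),
    [/\ 0 < M x, 0 < x & 1 < ln x].
  near=> x; split.
  - rewrite mulr_gt0 ?subr_gt0//.
    near: x; apply: (near_l (fun y => 0 < saddle_t beta y)).
    by apply: (cvgryPgt _).1; exact: cvg_saddle_t.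
  - by near: x; exact: nbhs_pinfty_gt.
  - by near: x; apply: (cvgryPgt _).1; exact: cvg_ln_pinfty.
have up : \forall x \near (+oo : set_system R), G_sum beta x <=
    x * expR (4 - 2 * ln (ln 2) + 3 * l x
     + (1 - beta) * (saddle_t beta (l x) * expR ((1 - beta)^-1 / l x))).
  near=> x; apply: G_sum_le => //.
  by near: x; apply: (cvgryPgt _).1; exact: cvg_ln_pinfty.
have lo : \forall x \near (+oo : set_system R),
    x * expR (- 5 - ln (saddle_t beta (l x)) - beta * saddle_t beta (l x)
     + (saddle_t beta (l x) - 1) * (1 + ln (saddle_ratio beta (l x))))
    <= G_sum beta x.
  near=> x; apply: (@G_sum_ge R beta hbeta x (l x) _
     (l x - 2 * ln (saddle_t beta (l x)) - 2)) => //.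
  - by near: x; apply: (cvgryPgt _).1; exact: cvg_ln_pinfty.
  - near: x; apply: (near_l (fun y => 1 <= saddle_t beta y)).
    by apply: (cvgryPge _).1; exact: cvg_saddle_t.
  - near: x; apply: (near_l (fun y => 1 < saddle_z beta y)).
    by apply: (cvgryPgt _).1; exact: cvg_saddle_z.
  - near: x; apply: (near_l (fun y => 0 < y - 2 * ln (saddle_t beta y) - 2)).
    near=> y.
    have y8 : 8 < y by near: y; exact: nbhs_pinfty_gt.
    have y0 : 0 < y by lra.
    have : ln (saddle_t beta y) / y < 4^-1.
      near: y; apply: (cvgr_lt 0); last by rewrite invr_gt0.
      exact: cvg_ln_saddle_t.
    rewrite ltr_pdivrMr//; lra.
  - near: x; apply: (near_l (fun y => - 1 <= ln (saddle_ratio beta y))).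
    near=> y.
    have qy : expR (- 1) < saddle_ratio beta y.
      near: y; apply: (cvgr_gt 1); first exact: cvg_saddle_ratio.
      by rewrite expR_lt1 oppr_lt0.
    by rewrite -[- 1]expRK ler_ln ?posrE ?expR_gt0 ?(lt_trans _ qy) ?expR_gt0// ltW.
(* The formula solved for [eps]; near infinity [M x], [x] and [G_sum beta x] are positive, so it can
   be solved back. *)
exists (fun x => ln (G_sum beta x / x) / M x - 1); split.
  apply: (@squeeze_cvgr _ _ _ _
    (fun x => (fun y => (- 5 - ln (saddle_t beta y) - beta * saddle_t beta y
      + (saddle_t beta y - 1) * (1 + ln (saddle_ratio beta y)))
      / ((1 - beta) * saddle_t beta y) - 1) (l x))
    (fun x => (fun y => (4 - 2 * ln (ln 2) + 3 * y
      + (1 - beta) * (saddle_t beta y * expR ((1 - beta)^-1 / y)))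
      / ((1 - beta) * saddle_t beta y) - 1) (l x))).
  - near=> x.
    have [M0 x0 _] : [/\ 0 < M x, 0 < x & 1 < ln x] by near: x.
    have U : G_sum beta x <= x * expR (4 - 2 * ln (ln 2) + 3 * l x
      + (1 - beta) * (saddle_t beta (l x) * expR ((1 - beta)^-1 / l x))) by near: x.
    have L : x * expR (- 5 - ln (saddle_t beta (l x)) - beta * saddle_t beta (l x)
      + (saddle_t beta (l x) - 1) * (1 + ln (saddle_ratio beta (l x))))
      <= G_sum beta x by near: x.
    have S0 : 0 < G_sum beta x.
      by apply: lt_le_trans L; rewrite mulr_gt0 ?expR_gt0.
    rewrite !lerD2r -/(M x) !ler_pM2r ?invr_gt0//.
    rewrite -ler_expR -[leRHS in _ && leRHS]ler_expR lnK ?posrE ?divr_gt0//.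
    by rewrite ler_pdivlMr// ler_pdivrMr// mulrC L mulrC U.
  - exact: cvg_comp l_oo (cvg_lower hbeta).
  - exact: cvg_comp l_oo (cvg_upper hbeta _).
near=> x.
have [M0 x0 lx] : [/\ 0 < M x, 0 < x & 1 < ln x] by near: x.
have L : x * expR (- 5 - ln (saddle_t beta (l x)) - beta * saddle_t beta (l x)
  + (saddle_t beta (l x) - 1) * (1 + ln (saddle_ratio beta (l x))))
  <= G_sum beta x by near: x.
have S0 : 0 < G_sum beta x.
  by apply: lt_le_trans L; rewrite mulr_gt0 ?expR_gt0.
have -> : (1 - beta) / (ln 2 `^ (beta / (1 - beta)))
   * iter_ln 2 x `^ (1 / (1 - beta)) = M x.
  by rewrite /M saddle_tE ?ln_gt0// mulrA div1r.
rewrite addrC subrK divfK ?gt_eqF// lnK ?posrE ?divr_gt0//.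
by rewrite mulrC divfK// gt_eqF.
Unshelve. all: by end_near. Qed.
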